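(* Let $0 < a \le 1$ and $\mathcal{F} = \{K_3^a, K_4^0\}$. Then $d(\mathcal{F}) = \frac{2}{4-a}$.
   Context: An edge weighting of a graph $G$ is a map $w : E(G) \to [0,1]$; for an $n$-vertex graph, $w(G) := \frac{2}{n^2}\sum_{e\in E(G)} w(e)$. A weighted clique is a pair $(r,f)$ with $f : \binom{[r]}{2} \to [0,1]$; $(G,w)$ contains $(r,f)$ if there is an injective $\phi:[r]\to V(G)$ with $\phi(i)\phi(j) \in E(G)$ and $w(\phi(i)\phi(j)) > f(ij)$ for all $i<j$. For $a \in [0,1]$, $K_r^a$ is the weighted clique $(r,f)$ with $f \equiv a$. For a set $\mathcal{F}$ of weighted cliques, $(G,w)$ is $\mathcal{F}$-free if it contains none of them; $\beta_n(\mathcal{F})$ is the maximum of $w(G)$ over $\mathcal{F}$-free weighted graphs on $n$ vertices, and $d(\mathcal{F}) := \lim_{n\to\infty}\beta_n(\mathcal{F})$. *)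

(* Defs.v *)
From HB Require Import structures.
From mathcomp Require Import all_boot all_order all_algebra.
From mathcomp Require Import interval_inference.
From mathcomp Require Import all_classical all_reals all_analysis.

Set Implicit Arguments.
Unset Strict Implicit.
Unset Printing Implicit Defensive.

Import Order.TTheory GRing.Theory Num.Theory.
Import numFieldNormedType.Exports.

Local Open Scope classical_set_scope.
Local Open Scope ring_scope.

(* Finite simple graph: the edges are 2-element sets of vertices. *)
Record sgraph (T : finType) := SGraph {
  edges :> {set {set T}};
  edges_card2 : forall e, e \in edges -> #|e| = 2%N }.

(* The type {i01 R} is the real interval [0, 1].  An edge weighting is total on
   {set T}; only its values on the edges of the graph are ever used. *)
Definition edge_weighting (R : realType) (T : finType) := {set T} -> {i01 R}.

Definition graph_weight (R : realType) (T : finType)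
    (G : sgraph T) (w : edge_weighting R T) : R :=
  2 / #|T|%:R ^+ 2 * \sum_(e in edges G) (w e)%:num.

(* A pair (r, f); only the values of f on 2-element sets are ever used. *)
Record wclique (R : realType) := WClique {
  wc_order : nat;
  wc_fun : {set 'I_wc_order} -> {i01 R} }.

Definition wcontains (R : realType) (T : finType)
    (G : sgraph T) (w : edge_weighting R T) (c : wclique R) : Prop :=
  exists phi : 'I_(wc_order c) -> T, injective phi /\
    forall i j : 'I_(wc_order c), (i < j)%N ->
      [set phi i; phi j]%SET \in edges G /\
      (wc_fun [set i; j]%SET)%:num < (w [set phi i; phi j]%SET)%:num.

Definition Kclique (R : realType) (r : nat) (a : {i01 R}) : wclique R :=
  @WClique R r (fun=> a).

Definition wfree (R : realType) (T : finType)
    (F : set (wclique R)) (G : sgraph T) (w : edge_weighting R T) : Prop :=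
  forall c, F c -> ~ wcontains G w c.

Definition free_weights (R : realType) (F : set (wclique R)) (n : nat) : set R :=
  [set x | exists (G : sgraph 'I_n) (w : edge_weighting R 'I_n),
     wfree F G w /\ x = graph_weight G w].

(* When some F-free weighted graph exists this supremum is a maximum: see
   beta_max below. *)
Definition beta (R : realType) (F : set (wclique R)) (n : nat) : R :=
  sup (free_weights F n).

Definition density (R : realType) (F : set (wclique R)) : R := limn (beta F).

Lemma beta_max (R : realType) (F : set (wclique R)) (n : nat) :
  free_weights F n !=set0 ->
  free_weights F n (beta F n) /\ ubound (free_weights F n) (beta F n).
Proof.
move=> A0.
suff [m Am ub_m] : exists2 m, free_weights F n m & ubound (free_weights F n) m.
  suff -> : beta F n = m by [].
  apply/eqP; rewrite eq_le; apply/andP; split; first exact: ge_sup.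
  by apply: ub_le_sup => //; exists m.
pose T : finType := {set 'I_n}.
have edges2 (e : T) : e \in [set e : T | #|e| == 2%N]%SET -> #|e| = 2%N.
  by rewrite inE => /eqP.
pose KG := SGraph edges2.
pose X := prod_topology (fun _ : T => R).
pose Box : set X := [set w | forall e, (`[0, 1]%classic : set R) (w e)].
pose W : set X := [set w | forall c : wclique R, F c ->
  forall phi : 'I_(wc_order c) -> 'I_n, injective phi ->
  exists ij : 'I_(wc_order c) * 'I_(wc_order c), (ij.1 < ij.2)%N /\
    w [set phi ij.1; phi ij.2]%SET <= (wc_fun [set ij.1; ij.2]%SET)%:num].
pose f (w : X) : R := 2 / #|'I_n|%:R ^+ 2 * \sum_(e in edges KG) w e.
have proj_cont (e : T) : continuous (fun w : X => w e : R).
  exact: (@proj_continuous T (fun=> R) e).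
have cBox : compact Box.
  by apply: (@tychonoff T (fun=> R) (fun=> `[0, 1]%classic)) => e; exact: segment_compact.
have clW : closed W.
  have -> : W = \bigcap_(c in F) \bigcap_(phi in [set phi : _ -> _ | injective phi])
     \bigcup_(ij in [set ij : 'I_(wc_order c) * 'I_(wc_order c) | (ij.1 < ij.2)%N])
     ((fun w : X => w [set phi ij.1; phi ij.2]%SET) @^-1`
        [set x | x <= (wc_fun [set ij.1; ij.2]%SET)%:num]).
    apply/seteqP; split => w h c Fc phi phi_inj; have := h c Fc phi phi_inj.
      by move=> [ij [? ?]]; exists ij.
    by move=> [ij ? ?]; exists ij.
  apply: closed_bigI => c Fc; apply: closed_bigI => phi phi_inj.
  apply: closed_bigcup => [|ij _]; first exact: finite_finset.
  by apply: closed_comp; [move=> w _; exact: proj_cont|exact: closed_le].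
have f_cont : continuous f.
  pose S (v : X) : R := \sum_(e in edges KG) v e.
  have add_cont : continuous (fun z : R * R => z.1 + z.2 : R).
    by move=> z; exact: (@cvgD R R _ _ _ fst snd _ _ cvg_fst cvg_snd).
  have S_cont : continuous S.
    exact: (@continuous_big R T +%R 0 (mem (edges KG)) add_cont X (index_enum T)
             (fun e v => v e) (fun e _ => proj_cont e)).
  move=> w.
  exact: (@cvgM R X (nbhs w) _ (cst (2 / #|'I_n|%:R ^+ 2)) S _ _
    (cvg_cst _) (S_cont w)).
have i01P (x : {i01 R}) : (`[0, 1]%classic : set R) x%:num.
  by rewrite /= in_itv /= !ge0 !le1.
have lift (G : sgraph 'I_n) (w : edge_weighting R 'I_n) : wfree F G w ->
    exists2 v, (Box `&` W) v & f v = graph_weight G w.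
  move=> Gw; exists (fun e => if e \in edges G then (w e)%:num else 0).
    split=> [e|c Fc phi phi_inj].
      by case: ifP => _; [exact: i01P|rewrite /= in_itv /= lexx ler01].
    apply: contrapT => nex; apply: (Gw c Fc); exists phi; split => // i j ij.
    have : ~ ((if [set phi i; phi j]%SET \in edges G
               then (w [set phi i; phi j]%SET)%:num else 0)
               <= (wc_fun [set i; j]%SET)%:num) by move=> h; apply: nex; exists (i, j).
    by case: ifP => _ /negP; rewrite -ltNge // ltNge ge0.
  rewrite /f /graph_weight; congr (_ * _).
  rewrite -big_mkcondr; apply: eq_bigl => e; rewrite inE andbC.
  by case: (boolP (e \in edges G)) => // /edges_card2 ->.
have unlift v : (Box `&` W) v -> free_weights F n (f v).
  move=> [Bv Wv].
  have v0 e : 0 <= v e by have := Bv e; rewrite /= in_itv => /andP[].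
  have v1 e : v e <= 1 by have := Bv e; rewrite /= in_itv => /andP[].
  exists KG, (fun e => Itv01 (v0 e) (v1 e)); split=> //.
  move=> c Fc [phi [phi_inj h]]; have [[i j] /= [ij]] := Wv c Fc phi phi_inj.
  by have [_ /=] := h i j ij; rewrite ltNge => /negP.
have [||v] := @compact_EVT_max X R f (Box `&` W) _ (compact_closedI cBox clW).
- by case: A0 => _ [G [w [/lift[v Av _] _]]]; exists v.
- exact: continuous_subspaceT.
rewrite inE => Av fmax; exists (f v); first exact: unlift.
move=> _ [G [w [/lift[u Au <-] ->]]]; apply: fmax; exact/mem_set.
Qed.

(* Main.v *)
(** Doubling the edge sum gives the quadratic form [sum x_i x_j W_ij] at
    [x = 1], so the upper bound is a Motzkin-Straus argument: as long as two
    vertices of the support are non-adjacent, all the mass of one can be moved to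
    the other without decreasing the form, so the support may be taken to be a
    clique. Since [K_4^0] is excluded it has at most three vertices, and if it is a
    triangle one of its edges has weight at most [a]; then, as
    [4 y z <= (y + z) ^ 2], the bound reduces to
    [0 <= (x - (1 - a / 2) (y + z)) ^ 2]. The extremal graphs are complete
    tripartite with parts of sizes [k], [k] and [n - 2 k], where [k] is about
    [n / (4 - a)], weight [a] between the two equal parts, and weight [1]
    elsewhere. *)
Require Import Defs.
From mathcomp Require Import all_boot all_order all_algebra.
From mathcomp Require Import interval_inference.
From mathcomp Require Import all_classical all_reals all_analysis.
From mathcomp Require Import ring lra.
Import Order.TTheory GRing.Theory Num.Theory.
Import numFieldNormedType.Exports.
Local Open Scope classical_set_scope.
Local Open Scope ring_scope.

(** * Quadratic forms and shifting mass between non-adjacent vertices *)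

Section QuadraticForm.
Variables (R : realDomainType) (T : finType) (W : T -> T -> R).
Hypotheses (W_sym : forall i j, W i j = W j i) (W_diag : forall i, W i i = 0).

Definition quad_form (A : {set T}) (x : T -> R) : R :=
  \sum_(i in A) \sum_(j in A) x i * x j * W i j.

Definition weighted_degree (A : {set T}) (x : T -> R) (u : T) : R :=
  \sum_(j in A) x j * W u j.

(** The zero diagonal makes the form affine in [x u], so that the effect of moving mass can be read
    off from weighted degrees. *)
Lemma quad_formD1 (A : {set T}) (x : T -> R) (u : T) : u \in A ->
  quad_form A x = quad_form (A :\ u)%SET x
                  + 2 * x u * weighted_degree (A :\ u)%SET x u.
Proof.
move=> uA; rewrite /quad_form (big_setD1 u)//= (big_setD1 u)//= W_diag mulr0 add0r.
under [X in _ + X = _]eq_bigr => i _ do rewrite (big_setD1 u)//=.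
rewrite big_split/= addrA addrC; congr (_ + _).
rewrite -mulrA mulr_natl mulr2n /weighted_degree !mulr_sumr; congr (_ + _).
  by apply: eq_bigr => i _; rewrite mulrA.
by apply: eq_bigr => i _; rewrite W_sym (mulrC (x i)) mulrA.
Qed.

Lemma eq_quad_form (A : {set T}) (x y : T -> R) : {in A, x =1 y} ->
  quad_form A x = quad_form A y.
Proof.
move=> xy; apply: eq_bigr => i iA; apply: eq_bigr => j jA.
by rewrite !xy.
Qed.

Lemma quad_form_le_clique (c : R) :
  (forall (A : {set T}) (x : T -> R), (forall i, 0 <= x i) ->
    {in A &, forall i j, i != j -> W i j != 0} ->
    quad_form A x <= c * (\sum_(i in A) x i) ^+ 2) ->
  forall (A : {set T}) (x : T -> R), (forall i, 0 <= x i) ->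
    quad_form A x <= c * (\sum_(i in A) x i) ^+ 2.
Proof.
move=> clique_le A; have [m] := ubnP #|A|; elim: m => // m IHm in A *.
rewrite ltnS => Am x x_ge0.
have [/forall_inP cl|] := boolP [forall i in A, forall j in A,
    (i != j) ==> (W i j != 0)].
  apply: clique_le => // i j iA jA ij.
  by move/forall_inP: (cl i iA) => /(_ j jA)/implyP; apply.
rewrite negb_forall_in => /exists_inP[u uA].
rewrite negb_forall_in => /exists_inP[v vA].
rewrite negb_imply negbK => /andP[uv /eqP Wuv].
(* By symmetry [u] has the larger degree. As [W u v = 0], both degrees may be taken outside [u] and
   [v]. *)
wlog le_vu : u v uA vA uv Wuv /
    weighted_degree (A :\ v :\ u)%SET x v <= weighted_degree (A :\ v :\ u)%SET x u.
  move=> wl; case: (leP (weighted_degree (A :\ v :\ u)%SET x v)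
                        (weighted_degree (A :\ v :\ u)%SET x u)) => [|/ltW] le_d.
    exact: (wl u v).
  apply: (wl v u) => //; first by rewrite eq_sym.
    by rewrite W_sym.
  by rewrite finset.setDDl finset.setUC -finset.setDDl.
pose y i := if i == u then x u + x v else x i.
have uAv : u \in (A :\ v)%SET by rewrite !inE uv.
have yE : {in (A :\ v :\ u)%SET, y =1 x}.
  by move=> i; rewrite !inE /y => /andP[/negbTE->].
have y_ge0 i : 0 <= y i by rewrite /y; case: ifP => // _; rewrite addr_ge0.
have Av_m : (#|(A :\ v)%SET| < m)%N.
  by move: Am; rewrite (cardsD1 v) vA add1n.
have := IHm _ Av_m y y_ge0.
have -> : \sum_(i in (A :\ v)%SET) y i = \sum_(i in A) x i.
  rewrite (big_setD1 v vA)/= !(big_setD1 u uAv)/= {1}/y eqxx (eq_bigr x)//.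
  by rewrite addrA [x v + _]addrC.
apply: le_trans.
(* After expansion at [v] and [u] the two sides differ only in [x v] times the degree of [v] against
   [x v] times that of [u]. *)
rewrite (quad_formD1 A x v)// !(quad_formD1 (A :\ v)%SET _ u)//.
rewrite (eq_quad_form _ _ _ yE).
have -> : weighted_degree (A :\ v :\ u)%SET y u = weighted_degree (A :\ v :\ u)%SET x u.
  by apply: eq_bigr => i iA; rewrite yE.
have -> : weighted_degree (A :\ v)%SET x v = weighted_degree (A :\ v :\ u)%SET x v.
  by rewrite /weighted_degree (big_setD1 u)//= W_sym Wuv mulr0 add0r.
rewrite /y eqxx -addrA lerD2l mulrDr mulrDl lerD2l ler_wpM2l//.
by rewrite mulr_ge0.
Qed.

End QuadraticForm.

Lemma triangle_weight_le (R : realFieldType) (a x y z p q r : R) :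
  0 <= a <= 1 -> 0 <= x -> 0 <= y -> 0 <= z -> p <= 1 -> q <= 1 -> r <= a ->
  (4 - a) * (x * y * p + x * z * q + y * z * r) <= (x + y + z) ^+ 2.
Proof.
move=> /andP[a0 a1] x0 y0 z0 p1 q1 ra.
have xyp : x * y * p <= x * y by rewrite ler_piMr ?mulr_ge0.
have xzq : x * z * q <= x * z by rewrite ler_piMr ?mulr_ge0.
have yzr : y * z * r <= y * z * a by rewrite ler_wpM2l ?mulr_ge0.
apply: (@le_trans _ _ ((4 - a) * (x * y + x * z + y * z * a))).
  by apply: ler_wpM2l; lra.
(* The last square is the slack in [4 y z <= (y + z) ^ 2]. Both squares vanish at [y = z],
   [x = (2 - a) y], the proportions of the extremal parts. *)
have -> : (x + y + z) ^+ 2 = (4 - a) * (x * y + x * z + y * z * a)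
   + ((x - (1 - a / 2) * (y + z)) ^+ 2 + (4 - a) * a / 4 * (y - z) ^+ 2) by field.
rewrite lerDl addr_ge0 ?sqr_ge0// mulr_ge0 ?sqr_ge0//.
by rewrite divr_ge0// mulr_ge0//; lra.
Qed.

(** * The weighted adjacency matrix and the upper bound *)

Section Adjacency.
Variables (R : realType) (T : finType) (G : sgraph T) (w : edge_weighting R T).

(** Non-edges count as weight 0. Clique thresholds are nonnegative and strict, so exceeding one
    already forces an edge. *)
Definition adj_weight (i j : T) : R :=
  if [set i; j]%SET \in edges G then (w [set i; j]%SET)%:num else 0.

Lemma adj_weight_sym i j : adj_weight i j = adj_weight j i.
Proof. by rewrite /adj_weight finset.setUC. Qed.

Lemma adj_weight_diag i : adj_weight i i = 0.
Proof.
rewrite /adj_weight; case: ifP => // /edges_card2.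
by rewrite cards2 eqxx.
Qed.

Lemma adj_weight_le1 i j : adj_weight i j <= 1.
Proof. by rewrite /adj_weight; case: ifP. Qed.

Lemma adj_weight_gt i j (b : {i01 R}) : b%:num < adj_weight i j ->
  [set i; j]%SET \in edges G /\ b%:num < (w [set i; j]%SET)%:num.
Proof. by rewrite /adj_weight; case: ifP => // _; rewrite ltNge ge0. Qed.

Lemma adj_weight_gt0 i j : adj_weight i j != 0 -> 0 < adj_weight i j.
Proof.
move=> h; rewrite lt_neqAle eq_sym h /adj_weight.
by case: ifP => _ /=; rewrite ?ge0 ?lexx.
Qed.

(** Each edge [[set x; y]] comes from exactly two ordered pairs, [(x, y)] and [(y, x)]. *)
Lemma sum_adj_weight :
  \sum_i \sum_j adj_weight i j = 2 * \sum_(e in edges G) (w e)%:num.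
Proof.
rewrite pair_big/= /adj_weight -big_mkcond/=.
rewrite (partition_big (fun p : T * T => [set p.1; p.2]%SET) (mem (edges G)))//=.
rewrite mulr_sumr; apply: eq_bigr => e eG.
have /eqP/cards2P[x [y [xy ex]]] := edges_card2 eG.
rewrite (eq_bigr (fun=> (w e)%:num)); last by move=> p /andP[_ /eqP->].
rewrite (eq_bigl (mem [set (x, y); (y, x)]%SET)).
  by rewrite sumr_const cards2 xpair_eqE (negbTE xy) /= mulr_natl.
move=> [i j] /=; rewrite !inE !xpair_eqE; apply/andP/orP.
  move=> [ijG /eqP eij].
  have ij : i != j by move/edges_card2: ijG; rewrite cards2; case: (i != j).
  have : i \in [set x; y]%SET by rewrite -ex -eij !inE eqxx.
  have : j \in [set x; y]%SET by rewrite -ex -eij !inE eqxx orbT.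
  move: ij; rewrite !inE => ij /orP[] /eqP ej /orP[] /eqP ei; move: ij;
    by rewrite ei ej !eqxx; auto.
by move=> [] /andP[/eqP-> /eqP->]; rewrite ?[[set y; x]%SET]finset.setUC -ex eG eqxx.
Qed.

(** Injectivity is automatic: a repeated vertex would give a diagonal weight above [b], but the
    diagonal is 0. *)
Lemma wcontains_Kclique (b : {i01 R}) (s : seq T) (x0 : T) :
  pairwise (fun i j => b%:num < adj_weight i j) s ->
  wcontains G w (Kclique (size s) b).
Proof.
move=> s_cl.
have s_uniq : uniq s.
  by apply: pairwise_uniq s_cl => i; rewrite adj_weight_diag ltNge ge0.
exists (fun i : 'I_(size s) => nth x0 s i); split.
  move=> i j /eqP; rewrite nth_uniq// => /eqP ij.
  exact/val_inj.
move=> i j ij; apply: adj_weight_gt.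
by move/(pairwiseP x0): s_cl; apply; rewrite ?inE.
Qed.

Lemma quad_form_clique_le (a : {i01 R}) :
  wfree [set Kclique 3 a; Kclique 4 0%:i01] G w ->
  forall (A : {set T}) (x : T -> R), (forall i, 0 <= x i) ->
  {in A &, forall i j, i != j -> adj_weight i j != 0} ->
  quad_form R T adj_weight A x <= 2 / (4 - a%:num) * (\sum_(i in A) x i) ^+ 2.
Proof.
move=> Gfree A x x_ge0 A_cl.
have a01 : 0 <= a%:num <= 1 by rewrite ge0 le1.
have a4 : 0 < 4 - a%:num by lra.
rewrite mulrAC ler_pdivlMr// mulrC.
have := enum_uniq A; rewrite uniq_pairwise => A_pw.
have {A_cl A_pw} : pairwise (fun i j => 0 < adj_weight i j) (enum A).
  apply: (@sub_in_pairwise _ (mem A) _ _ _ _ _ A_pw).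
    by move=> i j iA jA /= ij; apply/adj_weight_gt0/A_cl.
  by apply/allP => i; rewrite mem_enum.
rewrite /quad_form; under eq_bigr do rewrite -big_enum.
rewrite -!(big_enum _ _ A)/=.
(* Otherwise [u], [v], [t] would span a [K_3^a]. *)
have tri u v t : adj_weight u v <= a%:num \/ adj_weight u t <= a%:num \/
    adj_weight v t <= a%:num.
  case: (leP (adj_weight u v) a%:num) => [|uv]; first by left.
  case: (leP (adj_weight u t) a%:num) => [|ut]; first by right; left.
  case: (leP (adj_weight v t) a%:num) => [|vt]; first by right; right.
  exfalso; apply: (Gfree (Kclique 3 a)); first by left.
  by apply: (wcontains_Kclique a [:: u; v; t] u) => /=; rewrite uv ut vt.
case: (enum A) => [|u [|v [|t [|z s]]]].
- by rewrite !big_nil expr0n/= !mulr0.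
- rewrite !big_cons !big_nil !addr0 adj_weight_diag !mulr0 mulr_ge0// sqr_ge0//.
(* A single edge is a triangle whose third vertex has mass 0. *)
- rewrite !big_cons !big_nil !addr0 !adj_weight_diag (adj_weight_sym v u) => _.
  have := triangle_weight_le R a%:num (x u) (x v) 0 (adj_weight u v) 0 0 a01
    (x_ge0 u) (x_ge0 v) (lexx _) (adj_weight_le1 u v).
  by move=> /(_ ler01); lra.
- rewrite !big_cons !big_nil !addr0 !adj_weight_diag (adj_weight_sym v u).
  rewrite (adj_weight_sym t u) (adj_weight_sym t v) => _.
  have uv1 := adj_weight_le1 u v; have ut1 := adj_weight_le1 u t.
  have vt1 := adj_weight_le1 v t.
  (* The vertex opposite the light edge takes the role of [x] in [triangle_weight_le]. *)
  have [uv|[ut|vt]] := tri u v t.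
  + have := triangle_weight_le R _ _ _ _ _ _ _ a01
      (x_ge0 t) (x_ge0 u) (x_ge0 v) ut1 vt1 uv; lra.
  + have := triangle_weight_le R _ _ _ _ _ _ _ a01
      (x_ge0 v) (x_ge0 u) (x_ge0 t) uv1 vt1 ut; lra.
  + have := triangle_weight_le R _ _ _ _ _ _ _ a01
      (x_ge0 u) (x_ge0 v) (x_ge0 t) uv1 ut1 vt; lra.
move=> cl; exfalso; apply: (Gfree (Kclique 4 0%:i01)); first by right.
apply: (wcontains_Kclique _ [:: u; v; t; z] u); apply: subseq_pairwise cl.
exact: (prefix_subseq [:: u; v; t; z]).
Qed.

Lemma graph_weightE :
  graph_weight G w = (\sum_i \sum_j adj_weight i j) / #|T|%:R ^+ 2.
Proof. by rewrite sum_adj_weight mulrAC. Qed.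

Lemma graph_weight_le (a : {i01 R}) :
  wfree [set Kclique 3 a; Kclique 4 0%:i01] G w ->
  graph_weight G w <= 2 / (4 - a%:num).
Proof.
move=> Gfree; have a1 : a%:num <= 1 by rewrite le1.
have c_ge0 : 0 <= 2 / (4 - a%:num) by apply: divr_ge0 => //; lra.
rewrite graph_weightE.
(* With no vertices the weight is 0, because the inverse of 0 is 0. *)
have [T0|T0] := eqVneq (#|T|%:R : R) 0.
  by rewrite T0 expr0n invr0 mulr0.
have -> : \sum_i \sum_j adj_weight i j =
    quad_form R T adj_weight [set: T]%SET (fun=> 1).
  apply: eq_big => [i|i _]; first by rewrite inE.
  by apply: eq_big => [j|j _]; rewrite ?inE// !mul1r.
rewrite ler_pdivrMr ?exprn_even_gt0//.
have -> : #|T|%:R = \sum_(i in [set: T]%SET) (1 : R) by rewrite sumr_const cardsT.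
apply: quad_form_le_clique => //.
- exact: adj_weight_sym.
- exact: adj_weight_diag.
- exact: quad_form_clique_le.
Qed.

End Adjacency.

(** * The extremal tripartite graphs *)

Section Tripartite.
Variables (R : realType) (a : {i01 R}) (n k : nat).
Hypothesis kn : (k + k <= n)%N.

(* Parts 0 and 1 have [k] vertices each, part 2 has the remaining ones. *)
Definition part (i : 'I_n) : 'I_3 := inord ((k <= i) + (k + k <= i)).

Definition tripartite_edges : {set {set 'I_n}} :=
  [set e : {set 'I_n} | (#|e| == 2%N) && (#|part @: e| == 2%N)]%SET.

Lemma tripartite_card2 e : e \in tripartite_edges -> #|e| = 2%N.
Proof. by rewrite inE => /andP[/eqP]. Qed.

Definition tripartite := SGraph tripartite_card2.

(** [ord_max] is part 2, so only the edges between parts 0 and 1 get weight [a]. *)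
Definition tripartite_weight : edge_weighting R 'I_n :=
  fun e => if ord_max \in part @: e then 1%:i01 else a.

Lemma tripartite_edgeE i j :
  ([set i; j]%SET \in tripartite_edges) = (part i != part j).
Proof.
rewrite inE imsetU1 imset_set1 !cards2 !eqSS !eqb1.
by have [->|//] := eqVneq i j; rewrite eqxx.
Qed.

Lemma tripartite_weightE i j : tripartite_weight [set i; j]%SET =
  if (part i == ord_max) || (part j == ord_max) then 1%:i01 else a.
Proof. by rewrite /tripartite_weight imsetU1 imset_set1 !inE !(eq_sym ord_max). Qed.

(** An edge heavier than [a] meets part 2, but a triangle has only one vertex there and its opposite
    edge is too light. Four pairwise adjacent vertices would need four parts. *)
Lemma tripartite_free :
  wfree [set Kclique 3 a; Kclique 4 0%:i01] tripartite tripartite_weight.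
Proof.
move=> c [] -> [phi [_ /= h]].
  have {}h (i j : 'I_3) : (i < j)%N -> part (phi i) != part (phi j) /\
      ((part (phi i) == ord_max) || (part (phi j) == ord_max)).
    move=> /h[]; rewrite tripartite_edgeE tripartite_weightE => -> lt_a; split => //.
    by move: lt_a; case: ifP => //; rewrite ltxx.
  have := h (inord 0) (inord 1); have := h (inord 1) (inord 2).
  have := h (inord 0) (inord 2); rewrite !inordK//.
  move=> /(_ isT)[n02 m02] /(_ isT)[n12 m12] /(_ isT)[n01 m01].
  case/orP: m02 => /eqP p_max.
    move: m12; rewrite -p_max !(eq_sym _ (part (phi (inord 0)))).
    by rewrite (negbTE n01) (negbTE n02).
  by move: m01; rewrite -p_max (negbTE n02) (negbTE n12).
have : injective (part \o phi).
  move=> i j /= /eqP; apply: contraTeq.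
  by rewrite neq_ltn => /orP[] /h[]; rewrite tripartite_edgeE// eq_sym.
by move/leq_card; rewrite !card_ord.
Qed.

(** [A], [D - A] and [1 - D] are the indicators of parts 0, 1 and 2. *)
Let A (i : 'I_n) : R := (i < k)%N%:R.
Let D (i : 'I_n) : R := (i < k + k)%N%:R.

(** Each summand is a function of [i] times a function of [j], so the double sum factors into part
    sizes. *)
Lemma tripartite_adjE i j : adj_weight R _ tripartite tripartite_weight i j =
  (1 - D i) * D j + D i * (1 - D j) +
  (a%:num * A i * (D j - A j) + (D i - A i) * (a%:num * A j)).
Proof.
have partE (l : 'I_n) : part l = ((k <= l) + (k + k <= l))%N :> nat.
  by rewrite /part inordK//; case: (k <= l)%N; case: (k + k <= l)%N.
have kk (l : 'I_n) : (k + k <= l)%N -> (k <= l)%N.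
  by apply: leq_trans; rewrite leq_addr.
rewrite /adj_weight tripartite_edgeE tripartite_weightE -!val_eqE /= !partE.
rewrite /A /D !ltnNge; move: (kk i) (kk j).
case: (k + k <= i)%N => [->//|_]; case: (k + k <= j)%N => [->//|_];
  try case: (k <= i)%N; try case: (k <= j)%N; rewrite /=; ring.
Qed.

Lemma sum_ltn_ord (m : nat) : (m <= n)%N ->
  \sum_(i < n) ((i < m)%N%:R : R) = m%:R.
Proof.
move=> mn; rewrite -natr_sum -(big_mkord xpredT (fun i => (i < m)%N : nat))/=.
rewrite (big_cat_nat _ mn)//= [X in (X + _)%N]big_nat [X in (_ + X)%N]big_nat.
rewrite (eq_bigr (fun=> 1%N)); last by move=> i /andP[_ ->].
rewrite [X in (_ + X)%N]big1; last by move=> i /andP[mi _]; rewrite ltnNge mi.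
by rewrite -big_nat sum_nat_const_nat subn0 muln1 addn0.
Qed.

Lemma graph_weight_tripartite : graph_weight tripartite tripartite_weight =
  2 * (2 * n%:R * k%:R - (4 - a%:num) * k%:R ^+ 2) / n%:R ^+ 2.
Proof.
rewrite graph_weightE card_ord; congr (_ / _).
have sA : \sum_i A i = k%:R.
  by apply: sum_ltn_ord; apply: leq_trans kn; rewrite leq_addr.
have sD : \sum_i D i = k%:R + k%:R by rewrite -natrD; exact: sum_ltn_ord.
have sC : \sum_i (1 - D i) = n%:R - (k%:R + k%:R).
  by rewrite sumrB sD sumr_const card_ord.
have sB : \sum_i (D i - A i) = k%:R by rewrite sumrB sD sA addrK.
have sE : \sum_i a%:num * A i = a%:num * k%:R by rewrite -mulr_sumr sA.
under eq_bigr => i _ do under eq_bigr => j _ do rewrite tripartite_adjE.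
under eq_bigr => i _ do rewrite !big_split/=.
rewrite !big_split/= -!big_distrlr/= sD sC sB sE.
ring.
Qed.

End Tripartite.

(** * Bounds on [beta] and its limit *)

Section Bounds.
Variables (R : realType) (a : {i01 R}).
Let F : set (wclique R) := [set Kclique 3 a; Kclique 4 0%:i01].

Lemma free_weights_le n x : free_weights F n x -> x <= 2 / (4 - a%:num).
Proof. by move=> [G [w [Gw ->]]]; exact: graph_weight_le. Qed.

Lemma free_weights_tripartite n k : (k + k <= n)%N ->
  free_weights F n
    (2 * (2 * n%:R * k%:R - (4 - a%:num) * k%:R ^+ 2) / n%:R ^+ 2).
Proof.
move=> kn; exists (tripartite n k), (tripartite_weight R a n k).
by rewrite graph_weight_tripartite//; split => //; exact: tripartite_free.
Qed.

Lemma beta_le n : beta F n <= 2 / (4 - a%:num).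
Proof.
apply: ge_sup; last by move=> x; exact: free_weights_le.
(* The supremum needs a nonempty set; [k = 0] provides the edgeless graph. *)
by eexists; exact: (@free_weights_tripartite n 0).
Qed.

Lemma beta_ge n : (0 < n)%N -> 2 / (4 - a%:num) - 16 * harmonic n <= beta F n.
Proof.
move=> n_gt0; have a1 : a%:num <= 1 by rewrite le1.
have a0 : 0 <= a%:num by rewrite ge0.
have d_gt0 : 0 < 4 - a%:num by lra.
have nR : 1 <= n%:R :> R by rewrite ler1n.
(* [t] is the real maximizer of the tripartite weight, a concave quadratic in [k]; rounding down
   keeps [k + k <= n] since [4 - a >= 3]. *)
pose t : R := n%:R / (4 - a%:num); pose k := Num.truncn t.
have tE : t * (4 - a%:num) = n%:R by rewrite divfK// gt_eqF.
have t_ge0 : 0 <= t by rewrite divr_ge0// ltW.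
have /andP[kt tk] := truncn_itv t_ge0.
have kn : (k + k <= n)%N.
  rewrite -(ler_nat R) natrD -/k; move: kt; rewrite -/k => kt; nra.
apply: (@le_trans _ _
    (2 * (2 * n%:R * k%:R - (4 - a%:num) * k%:R ^+ 2) / n%:R ^+ 2)); last first.
  apply: ub_le_sup; last exact: free_weights_tripartite.
  by exists (2 / (4 - a%:num)) => x; exact: free_weights_le.
have n_neq0 : n%:R != 0 :> R by rewrite gt_eqF// ltr0n.
(* Completing the square isolates the rounding loss. It is at most [8 / n ^ 2], hence at most
   [16 / (n + 1)], which is [16 * harmonic n]. *)
have -> : 2 * (2 * n%:R * k%:R - (4 - a%:num) * k%:R ^+ 2) / n%:R ^+ 2 =
    2 / (4 - a%:num) - 2 * (4 - a%:num) * (t - k%:R) ^+ 2 / n%:R ^+ 2.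
  by rewrite /t; field; rewrite n_neq0 gt_eqF.
rewrite lerD2l lerN2 /harmonic/= ler_pdivrMr ?exprn_gt0 ?ltr0n//.
rewrite [leRHS]mulrAC ler_pdivlMr ?ltr0n//.
have tk1 : (t - k%:R) ^+ 2 <= 1.
  rewrite expr_le1// ?subr_ge0// lerBlDl; apply: ltW.
  by rewrite natr1.
apply: (@le_trans _ _ (8 * n.+1%:R)).
  rewrite ler_wpM2r//; have := sqr_ge0 (t - k%:R); nra.
by rewrite -natr1; nra.
Qed.

Lemma beta_cvg : beta F n @[n --> \oo] --> 2 / (4 - a%:num).
Proof.
apply: (@squeeze_cvgr _ _ _ _ (fun n => 2 / (4 - a%:num) - 16 * harmonic n)
  (fun=> 2 / (4 - a%:num))).
- by near=> n; rewrite beta_le beta_ge//; near: n; exact: nbhs_infty_gt.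
- have -> : nbhs (2 / (4 - a%:num)) = nbhs (2 / (4 - a%:num) - 16 * 0).
    by rewrite mulr0 subr0.
  by apply: cvgB; [exact: cvg_cst|apply: cvgMl_tmp; exact: cvg_harmonic].
- exact: cvg_cst.
Unshelve. all: by end_near. Qed.

End Bounds.

Theorem theorem3p3 (R : realType) (a : {i01 R}) (a_gt0 : 0 < a%:num) :
  let F : set (wclique R) := [set Kclique 3 a; Kclique 4 0%:i01] in
  cvgn (beta F) /\ density F = 2 / (4 - a%:num).
Proof.
by move=> F; split; [exact: (cvgP _ (beta_cvg R a))|exact/cvg_lim/(beta_cvg R a)].
Qed.
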